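(* Consider the M/G/1 queue with one-dependent server vacations (downtimes) described in the context, in steady state. Let $L$ be the number of customers in the system (including the one in service, if any) at an arbitrary point in time, let $\mathbb{E}[p^L\mid \text{server up}]$ and $\mathbb{E}[p^L\mid\text{server down}]$ be the probability generating functions of $L$ conditional on the server being up, respectively down, at that arbitrary point in time, let $U$ be an uptime, exponentially distributed with rate $\sigma$, and let $D$ be a downtime in stationarity. Then, for $|p|\le 1$, $$\mathbb{E}[p^L]=p_{up}\,\mathbb{E}[p^L\mid\text{server up}]+p_{down}\,\mathbb{E}[p^L\mid\text{server down}],$$ where $$p_{up}=\frac{\mathbb{E}[U]}{\mathbb{E}[U]+\mathbb{E}[D]}=\frac{1}{1+\sigma\mathbb{E}[D]},\qquad p_{down}=\frac{\mathbb{E}[D]}{\mathbb{E}[U]+\mathbb{E}[D]}=\frac{\sigma\mathbb{E}[D]}{1+\sigma\mathbb{E}[D]}.$$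
   Context: Single server model with one-dependent server vacations. Customers arrive at a single-server queue according to a Poisson process with rate $\lambda>0$. Service times are i.i.d. copies of a positive random variable $B$. The server alternates between uptimes $U(1),U(2),\dots$, which are i.i.d. exponentially distributed with rate $\sigma>0$, and downtimes (vacations) $D(1),D(2),\dots$, in the order $U(1),D(1),U(2),D(2),\dots$. During an uptime the server serves the customers; during a downtime no service takes place. Breakdowns occur irrespective of the state of the queue. If a customer is in service when the server goes down, the work done on that customer is lost and the service is restarted when the server comes up again (pre-emptive repeat). The arrival process, the service times, the uptimes and the sequence of downtimes are mutually independent. The downtimes are not independent of each other: each downtime depends on the preceding downtime through $$\mathbb{E}[e^{-sD(k+1)}\mid D(k)=t]=\chi(s)e^{-g(s)t},\qquad \mathrm{Re}(s)\ge 0,$$ where $\chi$ and $g$ are analytic functions with $\chi(0)=1$ and $g(0)=0$, $\chi$ is the Laplace–Stieltjes transform of a positive random variable, and $g$ has a completely monotone derivative, i.e. $(-1)^{n+1}\frac{d^n}{ds^n}g(s)\ge 0$ for all $n\ge1$. The random variable $D$ has the stationary distribution of $D(k)$ (the limit as $k\to\infty$), whose Laplace–Stieltjes transform $\widetilde D(s)=\mathbb{E}[e^{-sD}]$ satisfies $\widetilde D(s)=\chi(s)\widetilde D(g(s))$, and $\mathbb{E}[D]=\chi'(0)/(g'(0)-1)<\infty$. The stability condition $\lambda\mathbb{E}[B]<\mathbb{E}[U]/(\mathbb{E}[U]+\mathbb{E}[D])$ is assumed. ''At an arbitrary point in time'' refers to the time-stationary version of the process (in steady state), in which the consecutive cycles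 (uptime followed by downtime), seen from cycle starts, have the stationary law just described. *)

(* Defs.v *)
From HB Require Import structures.
From mathcomp Require Import all_boot all_order all_algebra complex.
From mathcomp Require Import all_classical all_reals all_analysis.
Set Implicit Arguments.
Unset Strict Implicit.
Unset Printing Implicit Defensive.
Import Order.TTheory GRing.Theory Num.Theory numFieldNormedType.Exports.
Local Open Scope classical_set_scope.
Local Open Scope ring_scope.
Local Open Scope complex_scope.

Section ComplexExpectation.
Context {R : realType} {d : measure_display} {T : measurableType d}.
Implicit Types (P : probability T R) (X : T -> R[i]).

Definition cexp (z : R[i]) : R[i] :=
  (expR (complex.Re z) * cos (complex.Im z))
  +i* (expR (complex.Re z) * sin (complex.Im z)).

Definition cintegrable P X : Prop :=
  P.-integrable [set: T] (fun w => (complex.Re (X w))%:E) /\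
  P.-integrable [set: T] (fun w => (complex.Im (X w))%:E).

Definition cexpect P X : R[i] :=
  (\int[P]_w complex.Re (X w)) +i* (\int[P]_w complex.Im (X w)).

Definition cexpect_on P (E : set T) X : R[i] :=
  cexpect P (fun w => X w * (\1_E w)%:C).

(* E[X | E], for an event E of positive probability *)
Definition cexpect_given P (E : set T) X : R[i] :=
  cexpect_on P E X / (fine (P E))%:C.

(* E[X | Y = t] = h t *)
Definition is_cond_expect P X (Y : {mfun T >-> R}) (h : R -> R[i]) : Prop :=
  [/\ cintegrable P X, cintegrable P (h \o Y) &
    forall A : set R, measurable A ->
      cexpect_on P (Y @^-1` A) X = cexpect_on P (Y @^-1` A) (h \o Y)].

End ComplexExpectation.

Section Independence.
Context {R : realType} {d : measure_display} {T : measurableType d}.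
Variable P : probability T R.

Definition independent (I : eqType) (F : I -> set (set T)) : Prop :=
  forall (J : seq I) (E : I -> set T), uniq J ->
    (forall i, i \in J -> F i (E i)) ->
    P (\bigcap_(i in [set` J]) E i) = (\prod_(i <- J) P (E i))%E.

Definition sigma_of (X : {mfun T >-> R}) : set (set T) :=
  preimage_set_system setT X measurable.

Definition sigma_of_family (I : Type) (X : I -> {mfun T >-> R}) :
  set (set T) := <<s \bigcup_i sigma_of (X i) >>.

Definition iid (I : eqType) (X : I -> {mfun T >-> R}) : Prop :=
  independent (fun i => sigma_of (X i)) /\
  forall i j (A : set R), measurable A ->
    distribution P (X i) A = distribution P (X j) A.

Definition poisson_process (lambda : R) (S : int -> {mfun T >-> R}) : Prop :=
  forall (n : nat) (a : nat -> R) (k : nat -> nat),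
    (forall i, a i < a i.+1) ->
    P (\bigcap_(i < n)
         [set w | ([set m : int | a i < S m w <= a i.+1] #= `I_(k i))%card])
    = (\prod_(i < n) poisson_pmf (lambda * (a i.+1 - a i)) (k i))%:E.

End Independence.

(* Two readings of "the service is restarted" after a breakdown: with the same
   service requirement, or with a freshly drawn one. *)
Inductive repeat_rule := RepeatIdentical | RepeatDifferent.

(* Everything is indexed by the integers: the processes run over the whole
   time line, index 0 being the last cycle start (the last arrival) in
   ]-oo, 0].  [service X n j] is the variable drawn for attempt [j] at serving
   customer [n]. *)
Record vacation_queue (R : realType) (d : measure_display)
    (T : measurableType d) := VacationQueue {
  cycle_start : int -> {mfun T >-> R};
  uptime : int -> {mfun T >-> R};
  downtime : int -> {mfun T >-> R};
  arrival : int -> {mfun T >-> R};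
  service : int -> nat -> {mfun T >-> R};
  departure : int -> {mfun T >-> R};
  queue_length : R -> {mfun T >-> nat} }.

Section Dynamics.
Context {R : realType} {d : measure_display} {T : measurableType d}.
Variables (rule : repeat_rule) (X : vacation_queue R T).

Definition cycle_down (k : int) (w : T) : R := cycle_start X k w + uptime X k w.

Definition server_up (t : R) : set T :=
  [set w | exists k, cycle_start X k w <= t < cycle_down k w].

Definition server_down (t : R) : set T :=
  [set w | exists k, cycle_down k w <= t < cycle_start X (k + 1) w].

Definition service_requirement (n : int) (j : nat) : T -> R :=
  match rule with
  | RepeatIdentical => service X n 0%N
  | RepeatDifferent => service X n j
  end.

(* First come, first served. *)
Definition head_of_line (n : int) (w : T) : R :=
  Num.max (arrival X n w) (departure X (n - 1) w).

Definition attempt_start (n k : int) (w : T) : R :=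
  Num.max (head_of_line n w) (cycle_start X k w).

Definition attempt_end (n k : int) (j : nat) (w : T) : R :=
  attempt_start n k w + service_requirement n j w.

(* Uptime [k] is the first one not over when customer [n] reaches the head of
   the line; there is one attempt per uptime from then on, and attempt [j] is
   the first that is completed before the server goes down. *)
Definition served (n : int) (w : T) : Prop :=
  exists (k : int) (j : nat),
    [/\ cycle_down (k - 1) w <= head_of_line n w < cycle_down k w,
        forall i : nat, (i < j)%N ->
          cycle_down (k + i%:Z) w < attempt_end n (k + i%:Z) i w,
        attempt_end n (k + j%:Z) j w <= cycle_down (k + j%:Z) w &
        departure X n w = attempt_end n (k + j%:Z) j w].

Record queue_dynamics : Prop := QueueDynamics {
  uptime_gt0 : forall k w, 0 < uptime X k w;
  downtime_gt0 : forall k w, 0 < downtime X k w;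
  service_gt0 : forall n j w, 0 < service X n j w;
  cycle_succ : forall k w,
    cycle_start X (k + 1) w = cycle_down k w + downtime X k w;
  cycle_origin : forall w, cycle_start X 0 w <= 0 < cycle_start X 1 w;
  cycle_cover : forall t w, exists k,
    cycle_start X k w <= t < cycle_start X (k + 1) w;
  arrival_succ : forall n w, arrival X n w < arrival X (n + 1) w;
  arrival_origin : forall w, arrival X 0 w <= 0 < arrival X 1 w;
  arrival_cover : forall t w, exists n,
    arrival X n w <= t < arrival X (n + 1) w;
  departureP : forall n w, served n w;
  queue_lengthP : forall t w,
    ([set n | (arrival X n w <= t < departure X n w)%R]
       #= `I_(queue_length X t w))%card }.

End Dynamics.

Section Stationarity.
Context {R : realType} {d : measure_display} {T : measurableType d}.
Variables (P : probability T R) (theta : R -> T -> T).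

Record stationary_flow : Prop := StationaryFlow {
  flow0 : forall w, theta 0 w = w;
  flowD : forall s t w, theta (s + t) w = theta s (theta t w);
  flow_measurable :
    measurable_fun [set: R * T] (fun z : R * T => theta z.1 z.2);
  flow_invariant : forall t (A : set T), measurable A ->
    P (theta t @^-1` A) = P A }.

(* [theta t] moves the time origin to [t]: up to renumbering the cycles and
   the customers, all epochs are translated by [- t]. *)
Record flow_compatible (X : vacation_queue R T) : Prop := FlowCompatible {
  cycle_shift : forall t w, exists m : int, forall k,
    [/\ cycle_start X k (theta t w) = cycle_start X (k + m) w - t,
        uptime X k (theta t w) = uptime X (k + m) w &
        downtime X k (theta t w) = downtime X (k + m) w];
  customer_shift : forall t w, exists m : int, forall n,
    [/\ arrival X n (theta t w) = arrival X (n + m) w - t,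
        departure X n (theta t w) = departure X (n + m) w - t &
        forall j, service X n j (theta t w) = service X (n + m) j w] }.

(* [P0] is the Palm probability of [P] for the point process [S] of intensity
   [nu], that is, the law of the stationary process seen from a point of [S]. *)
Definition is_palm (S : int -> {mfun T >-> R}) (nu : R) (P0 : probability T R) :
    Prop :=
  0 < nu /\
  forall A : set T, measurable A ->
    (nu%:E * P0 A =
     \int[P]_w \esum_(k in [set k | (0 < S k w <= 1)%R])
                 (\1_A (theta (S k w) w))%:E)%E.

End Stationarity.

Section Law.
Context {R : realType}.

Definition holomorphic_right_half_plane (f : R[i] -> R[i]) : Prop :=
  (forall z : R[i]^o, 0 < complex.Re z ->
     derivable (f : R[i]^o -> R[i]^o) z 1) /\
  {within [set z : R[i]^o | 0 <= complex.Re z],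
     continuous (f : R[i]^o -> R[i]^o)}.

Definition is_LST_of_positive (f : R[i] -> R[i]) : Prop :=
  exists mu : probability (measurableTypeR R) R,
    mu `]0, +oo[%classic = 1%E /\
    forall s : R[i], 0 <= complex.Re s ->
      f s = cexpect mu (fun x : R => cexp (- (s * x%:C))).

(* The order of R[i] makes [0 <= z] include that [z] is real. *)
Definition completely_monotone_derivative (f : R[i] -> R[i]) : Prop :=
  forall (n : nat) (s : R), (0 < n)%N -> 0 < s ->
    0 <= (-1) ^+ n.+1 * derive1n n (f : R[i]^o -> R[i]^o) s%:C.

Record transition_functions (chi g : R[i] -> R[i]) : Prop :=
  TransitionFunctions {
  chi_analytic : holomorphic_right_half_plane chi;
  g_analytic : holomorphic_right_half_plane g;
  chi0 : chi 0 = 1;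
  g0 : g 0 = 0;
  chi_LST : is_LST_of_positive chi;
  g_cm : completely_monotone_derivative g }.

(* The boundary point 0 only allows for a one-sided derivative. *)
Definition right_derivative0 (f : R[i] -> R[i]) (l : R) : Prop :=
  (fun h : R => (h^-1)%:C * (f h%:C - f 0) : R[i]^o) @ 0^'+
    --> (l%:C : R[i]^o).

Context {d : measure_display} {T : measurableType d}.
Variables (P0 : probability T R) (X : vacation_queue R T).

Record model_law (lambda sigma : R) (chi g : R[i] -> R[i]) : Prop := ModelLaw {
  arrival_law : poisson_process P0 lambda (arrival X);
  service_law : iid P0 (fun nj : int * nat => service X nj.1 nj.2);
  uptime_iid : iid P0 (uptime X);
  uptime_law : forall k (A : set R), measurable A ->
    distribution P0 (uptime X k) A = exponential_prob sigma A;
  primitives_independent : independent P0 (tnth [tuple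
    sigma_of_family (arrival X);
    sigma_of_family (fun nj : int * nat => service X nj.1 nj.2);
    sigma_of_family (uptime X);
    sigma_of_family (downtime X)]);
  downtime_transition : forall k (s : R[i]), 0 <= complex.Re s ->
    is_cond_expect P0
      (fun w => cexp (- (s * (downtime X (k + 1) w)%:C)))
      (downtime X k)
      (fun t => chi s * cexp (- (g s * t%:C)));
  downtime_stationary : forall k (A : set R), measurable A ->
    distribution P0 (downtime X k) A = distribution P0 (downtime X 0) A;
  downtime_LST : forall s : R[i], 0 <= complex.Re s ->
    cexpect P0 (fun w => cexp (- (s * (downtime X 0 w)%:C))) =
    chi s * cexpect P0 (fun w => cexp (- (g s * (downtime X 0 w)%:C)));
  downtime_mean : exists dchi0 dg0 : R,
    [/\ right_derivative0 chi dchi0, right_derivative0 g dg0 &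
        'E_P0[downtime X 0] = (dchi0 / (dg0 - 1))%:E]%E }.

Definition mean_uptime : R := fine 'E_P0[uptime X 0]%E.

Definition mean_downtime : R := fine 'E_P0[downtime X 0]%E.

Definition stable (lambda : R) : Prop :=
  (lambda%:E * 'E_P0[service X 0 0%N]
    < (mean_uptime / (mean_uptime + mean_downtime))%:E)%E.

End Law.

(* Main.v *)
Require Import Defs.
From HB Require Import structures.
From mathcomp Require Import all_boot all_order all_algebra complex.
From mathcomp Require Import all_classical all_reals all_analysis.
From mathcomp Require Import measurable_realfun.
From mathcomp Require Import ring lra zify.
Import Order.TTheory GRing.Theory Num.Theory numFieldNormedType.Exports.
Local Open Scope classical_set_scope.
Local Open Scope ring_scope.
Local Open Scope complex_scope.

(** At time [t] the server is either up or down, so [E[p^L]] splits into an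
    expectation over each of the two complementary events, and each of these is
    the probability of the event times the conditional expectation.  All the
    content is therefore in the two probabilities, which relate the
    time-stationary law [P] to the means of [U] and [D] under the Palm law [P0].

    The link is the inversion formula [palm_inversion]: attach to the [k]-th
    point [S_k] of a stationary point process of intensity [nu] an interval
    [S_k, S_k + V_k) that ends no later than the next point; then the
    probability that [t] lies in one of these intervals is [nu E0[V_0]].  Its
    proof is a mass transport.  By the layer cake formula,
    [nu E0[V_0] = \int_(x >= 0) nu P0(V_0 > x) dx].  By definition of the Palm
    law, [nu P0(V_0 > x)] is the mean number of points in (0, 1] whose mark
    exceeds [x].  Moving the time origin to [-x], it is also the mean number of
    points [S_k] with [S_k + x] in (0, 1] and [V_k > x] ([palm_tail]): each
    point is now counted at the instant [u = S_k + x] of its own interval.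
    Summing over [k], exchanging integrals and substituting [u] for [x] turns
    the whole into the mean time during (0, 1] that is covered by the intervals,
    and by stationarity this is the probability of being covered at time [t].

    The intervals with [V = U] are the uptimes, so [P(up) = nu E[U]]; the
    intervals with [V = U + D] fill the whole line, so [nu (E[U] + E[D]) = 1].
    Together they give [P(up) = E[U] / (E[U] + E[D])].  The second form of
    [p_up] and [p_down] comes from [E[U] = 1 / sigma]. *)

(** * Sums over countable index types *)

Section CountableSums.
Local Open Scope ereal_scope.

(** Numbering the index type by [pickle] turns an unordered sum into a series,
    for which monotone convergence is available; the codes that are not reached
    contribute [0]. *)
Lemma esum_countType (R : realType) (I : countType) (a : I -> \bar R) :
  (forall i, 0 <= a i) ->
  \esum_(i in [set: I]) a i = \sum_(n <oo) oapp a 0 (pickle_inv n).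
Proof.
move=> a0; rewrite nneseries_esumT; last by move=> n; case: pickle_inv => /=.
have pickle_inj : set_inj [set: I] (@pickle I).
  by move=> i j _ _; exact: (pcan_inj pickleK).
transitivity (\esum_(i in [set: I]) oapp a 0 (pickle_inv (pickle i))).
  by apply: eq_esum => i _; rewrite pickleK_inv.
rewrite -(esum_image _ _ (fun n => oapp a 0 (pickle_inv n)) pickle_inj).
rewrite esum_mkcond.
apply: eq_esum => n _; case: ifPn => // /negP; rewrite inE => n_out.
case E : (pickle_inv n) => [i|] //=; exfalso; apply: n_out; exists i => //.
by have := @pickle_invK I n; rewrite /ocancel E.
Qed.

Lemma ge0_integral_esum d (T : measurableType d) (R : realType)
    (mu : {measure set T -> \bar R}) (I : countType) (f : I -> T -> \bar R) :
  (forall i, measurable_fun [set: T] (f i)) -> (forall i x, 0 <= f i x) ->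
  \int[mu]_x (\esum_(i in [set: I]) f i x) =
  \esum_(i in [set: I]) \int[mu]_x f i x.
Proof.
move=> mf f0; rewrite esum_countType; last first.
  by move=> i; apply: integral_ge0 => x _; exact: f0.
under eq_integral do rewrite esum_countType//.
rewrite integral_nneseries//; last 2 first.
- by move=> n; case: pickle_inv => /=.
- by move=> n x _; case: pickle_inv => /=.
by apply: eq_eseriesr => n _; case: pickle_inv => //=; exact: integral0.
Qed.

Lemma measurable_esum d (T : measurableType d) (R : realType)
    (I : countType) (f : I -> T -> \bar R) :
  (forall i, measurable_fun [set: T] (f i)) -> (forall i x, 0 <= f i x) ->
  measurable_fun [set: T] (fun x => \esum_(i in [set: I]) f i x).
Proof.
move=> mf f0; under eq_fun do rewrite esum_countType//.
apply: ge0_emeasurable_sum => [n x _ _|n _]; by case: pickle_inv => /=.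
Qed.

(** Sigma-additivity for families indexed by any countable type:
    pointwise, the indicator of the union is the sum of the indicators, since at
    most one of them is non-zero. *)
Lemma measure_esum d (T : measurableType d) (R : realType)
    (mu : {measure set T -> \bar R}) (I : countType) (F : I -> set T) :
  (forall i, measurable (F i)) -> trivIset [set: I] F ->
  mu (\bigcup_i F i) = \esum_(i in [set: I]) mu (F i).
Proof.
move=> mF tF.
have mUF : measurable (\bigcup_i F i) by exact: countable_bigcupT_measurable.
transitivity (\int[mu]_x \esum_(i in [set: I]) (\1_(F i) x)%:E); last first.
  rewrite ge0_integral_esum//; last first.
    by move=> i; exact/measurable_EFinP/measurable_indic.
  by apply: eq_esum => i _; rewrite integral_indic// setIT.
rewrite -[in LHS](setIT (\bigcup_i F i)) -integral_indic//.
apply: eq_integral => x _; rewrite indicE.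
have [|xF] := boolP (x \in _); last first.
  rewrite esum1// => i _; rewrite indicE memNset// => Fix.
  by move/negP: xF; apply; rewrite inE; exists i.
rewrite inE => -[i0 _ Fx]; rewrite (_ : 1%:E = (\1_(F i0) x)%:E); last first.
  by rewrite indicE mem_set.
rewrite -(@esum_set1 R I i0 (fun i => (\1_(F i) x)%:E))//.
rewrite esum_mkcond; apply: eq_esum => i _; case: ifPn => // /negP; rewrite inE.
move=> /= ii0; rewrite indicE memNset// => Fix; apply: ii0.
by apply: (tF i i0) => //; exists x.
Qed.

End CountableSums.

(** * Indicators, sections and translations *)

(** Both sides are measures in [A], so they need only agree on the intervals
    that generate the Borel sets. *)
Lemma lebesgue_measure_translate (R : realType) (c : R) (A : set R) :
  measurable A ->
  lebesgue_measure ((fun x => c + x) @^-1` A) = lebesgue_measure A.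
Proof.
pose GR := measurableTypeR R.
have mc : @measurable_fun _ _ GR GR [set: R] (fun x : R => c + x).
  exact: (@measurable_funD _ R R).
pose mc_mfun : {mfun GR >-> GR} :=
  HB.pack (fun x : R => c + x) (isMeasurableFun.Build _ _ GR GR _ mc).
move=> mA; rewrite -[LHS]/(pushforward lebesgue_measure mc_mfun A).
apply/esym/lebesgue_measure_unique => //.
move=> _ [[a b] _ <-]; rewrite /pushforward /=.
rewrite [X in _ = lebesgue_measure X](_ : _ = `]a - c, b - c]%classic); last first.
  by apply/seteqP; split=> x /=; rewrite !in_itv/= ltrBlDl lerBrDl.
rewrite !lebesgue_measure_itv/= !lte_fin ltrD2r; case: ifP => // _.
by rewrite -!EFinB; congr EFin; ring.
Qed.

Lemma measurable_pred d (T : measurableType d) (b : T -> bool) :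
  measurable_fun [set: T] b -> measurable [set x | b x].
Proof.
move=> mb; rewrite -[X in measurable X]setTI.
exact: (mb measurableT [set true]).
Qed.

Lemma indic_pred (R : pzRingType) (T : Type) (b : T -> bool) x :
  \1_[set y | b y] x = (b x)%:R :> R.
Proof.
rewrite indicE; have [bx|bx] := boolP (b x); first by rewrite mem_set.
by rewrite memNset//; exact/negP.
Qed.

(** Tonelli for an indicator function: the product measure of [A] can be
    computed by slicing in either direction. *)
Lemma integral_sections d1 d2 (T1 : measurableType d1) (T2 : measurableType d2)
    (R : realType) (m1 : {sigma_finite_measure set T1 -> \bar R})
    (m2 : {sigma_finite_measure set T2 -> \bar R}) (A : set (T1 * T2)) :
  measurable A ->
  (\int[m1]_x m2 (xsection A x) = \int[m2]_y m1 (ysection A y))%E.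
Proof.
move=> mA; have := indic_fubini_tonelli m1 m2 mA.
by rewrite indic_fubini_tonelli_FE// indic_fubini_tonelli_GE.
Qed.

(** * The Palm inversion formula *)

Section PalmInversion.
Context {R : realType} {d : measure_display} {T : measurableType d}.
Context {P P0 : probability T R} {theta : R -> T -> T} {nu : R}.
Context {S V : int -> {mfun T >-> R}}.
Hypothesis S_lt : forall n w, S n w < S (n + 1) w.
Hypothesis S_origin : forall w, S 0 w <= 0 < S 1 w.
Hypothesis V_ge0 : forall n w, 0 <= V n w.
Hypothesis V_le : forall n w, S n w + V n w <= S (n + 1) w.
Hypothesis steady : stationary_flow P theta.
Hypothesis palm : is_palm P theta S nu P0.
Hypothesis shift : forall t w, exists m : int, forall k,
  S k (theta t w) = S (k + m) w - t /\ V k (theta t w) = V (k + m) w.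

Definition covered (t : R) : set T :=
  [set w | exists k, S k w <= t < S k w + V k w].

Lemma point_le k (j : nat) w : S k w <= S (k + j%:Z) w.
Proof.
elim: j => [|j IH]; first by rewrite addr0.
by apply: (le_trans IH); rewrite -addn1 PoszD addrA; exact/ltW/S_lt.
Qed.

Lemma index_unique k m w t :
  S k w <= t < S (k + 1) w -> S m w <= t < S (m + 1) w -> m = k.
Proof.
move=> /andP[k1 k2] /andP[m1 m2]; case: (ltgtP m k) => // mk; exfalso.
- have := point_le (m + 1) (absz (k - (m + 1))%R) w.
  rewrite (_ : m + 1 + _ = k); last lia.
  lra.
- have := point_le (k + 1) (absz (m - (k + 1))%R) w.
  rewrite (_ : k + 1 + _ = m); last lia.
  lra.
Qed.

(** Seen from the point [S k w], that point is the last one in (-oo, 0], so it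
    is the one numbered [0].  Shifting the origin may renumber the points by an
    arbitrary amount, but the position of the origin determines the amount. *)
Lemma mark_at_point k w : V 0 (theta (S k w) w) = V k w.
Proof.
have [m Sm] := shift (S k w) w; have [_ ->] := Sm 0; rewrite add0r.
congr (V _ w); apply: (@index_unique _ _ w (S k w)); first by rewrite lexx S_lt.
have := S_origin (theta (S k w) w).
by rewrite (Sm 0).1 (Sm 1).1 add0r subr_le0 subr_gt0 addrC.
Qed.

Lemma measurable_flow t : measurable_fun [set: T] (theta t).
Proof. exact: measurable_fun_pair2 (flow_measurable steady). Qed.

Lemma integral_flow t (h : T -> \bar R) :
  measurable_fun [set: T] h -> (forall w, (0 <= h w)%E) ->
  (\int[P]_w h (theta t w) = \int[P]_w h w)%E.
Proof.
move=> mh h0.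
rewrite -[LHS](ge0_integral_pushforward (measurable_flow t) P measurableT)//.
apply: eq_measure_integral => [|? A mA _]; first exact: measurable_flow.
exact: (flow_invariant steady t mA).
Qed.

Lemma esum_shift (m : int) (a : int -> \bar R) :
  (\esum_(k in [set: int]) a (k + m)%R = \esum_(k in [set: int]) a k)%E.
Proof.
apply/esym/(reindex_esum [set: int] [set: int] (fun k => k + m)); split => //.
- by move=> i j _ _ /addIr.
- by move=> i _; exists (i - m) => //; rewrite subrK.
Qed.

(** The Palm law counts the points in (0, 1].  By stationarity the window
    (0, 1] may be replaced by (-x, 1 - x], with the same [x] as in the tail
    of the mark: then [S k w + x] is an instant of (0, 1], and for [0 <= x] it
    lies in the interval attached to the point because [x < V k w]. *)
Lemma palm_tail x : (nu%:E * P0 [set w | (x < V 0 w)%R] =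
  \esum_(k in [set: int])
     P [set w | ((0 < S k w + x <= 1) && (x < V k w))%R])%E.
Proof.
pose E (y : R) k : set T := [set w | (0 < S k w + y <= 1) && (x < V k w)].
have mE y k : measurable (E y k).
  apply: measurable_pred; apply: measurable_and; last exact: measurable_fun_ltr.
  apply: measurable_and.
    by apply: measurable_fun_ltr => //; exact: measurable_funD.
  by apply: measurable_fun_ler => //; exact: measurable_funD.
have m1E y k : measurable_fun [set: T] (fun w => (\1_(E y k) w)%:E : \bar R).
  exact/measurable_EFinP/measurable_indic.
have -> : (nu%:E * P0 [set w | (x < V 0 w)%R] =
    \int[P]_w (\esum_(k in [set: int]) (\1_(E 0 k) w)%:E))%E.
  rewrite palm.2; last by apply: measurable_pred; exact: measurable_fun_ltr.
  apply: eq_integral => w _; rewrite esum_mkcond; apply: eq_esum => k _.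
  rewrite /E !indic_pred addr0; case: ifPn => [|/negP]; rewrite inE => /= Sk.
    by rewrite mark_at_point Sk.
  by case: (_ <= 1) Sk; case: (0 < _).
rewrite -(integral_flow (- x)); last 2 first.
- exact: measurable_esum.
- by move=> w; apply: esum_ge0 => k _; rewrite lee_fin.
transitivity (\esum_(k in [set: int]) \int[P]_w (\1_(E x k) w)%:E)%E; last first.
  by apply: eq_esum => k _; rewrite integral_indic// setIT.
rewrite -ge0_integral_esum//.
apply: eq_integral => w _; have [m Sm] := shift (- x) w.
rewrite -[RHS](esum_shift m); apply: eq_esum => k _.
by rewrite /E !indic_pred; have [-> ->] := Sm k; rewrite opprK addr0.
Qed.

Lemma measurable_covered t : measurable (covered t).
Proof.
rewrite (_ : covered t = \bigcup_k [set w | S k w <= t < S k w + V k w]).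
  apply: countable_bigcupT_measurable => // k.
  apply: measurable_pred; apply: measurable_and.
    exact: measurable_fun_ler.
  by apply: measurable_fun_ltr => //; exact: measurable_funD.
by apply/seteqP; split=> w [k]; exists k.
Qed.

Lemma measure_covered_flow t : P (covered t) = P (covered 0).
Proof.
rewrite -(flow_invariant steady t (measurable_covered 0)).
congr (P _); apply/seteqP; split=> w [k Hk]; have [m Sm] := shift t w.
  exists (k - m); have [-> ->] := Sm (k - m).
  by rewrite subrK; lra.
by exists (k + m); have [SE VE] := Sm k; rewrite SE VE in Hk; lra.
Qed.

(** The intervals attached to different points are disjoint. *)
Lemma measure_covered_esum t : P (covered t) =
  (\esum_(k in [set: int]) P [set w | (S k w <= t < S k w + V k w)%R])%E.
Proof.
rewrite -measure_esum.
- by congr (P _); apply/seteqP; split=> w [k]; exists k.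
- move=> k; apply: measurable_pred; apply: measurable_and.
    exact: measurable_fun_ler.
  by apply: measurable_fun_ltr => //; exact: measurable_funD.
- move=> i j _ _ [w [/= iw jw]]; have := V_le i w; have := V_le j w => jV iV.
  by apply: (@index_unique _ _ w t); lra.
Qed.

(** Integrating [palm_tail] over [x >= 0] gives, for each [k], the measure of a
    region of pairs [(x, w)]; the shear [u = S k w + x] preserves that measure
    and maps the region to the pairs [(u, w)] such that [u] is in (0, 1] and
    in the interval attached to the point [k]. *)
Lemma palm_inversion t : (nu%:E * 'E_P0[V 0] = P (covered t))%E.
Proof.
pose GR := measurableTypeR R; pose mu := @lebesgue_measure R.
pose A k : set (GR * T) := [set z |
  (0 <= z.1) && ((0 < S k z.2 + z.1 <= 1) && (z.1 < V k z.2))].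
pose B k : set (GR * T) := [set z |
  (0 < z.1 <= 1) && (S k z.2 <= z.1 < S k z.2 + V k z.2)].
have m1 : measurable_fun [set: GR * T] (fun z => z.1 : R) by exact: measurable_fst.
have mS k : measurable_fun [set: GR * T] (fun z => S k z.2).
  by apply: measurableT_comp => //; exact: measurable_snd.
have mV k : measurable_fun [set: GR * T] (fun z => V k z.2).
  by apply: measurableT_comp => //; exact: measurable_snd.
have mA k : measurable (A k).
  apply: measurable_pred; apply: measurable_and; first exact: measurable_fun_ler.
  apply: measurable_and; last exact: measurable_fun_ltr.
  apply: measurable_and.
    by apply: measurable_fun_ltr => //; exact: measurable_funD.
  by apply: measurable_fun_ler => //; exact: measurable_funD.
have mB k : measurable (B k).
  apply: measurable_pred; apply: measurable_and; apply: measurable_and.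
  - exact: measurable_fun_ltr.
  - exact: measurable_fun_ler.
  - exact: measurable_fun_ler.
  - by apply: measurable_fun_ltr => //; exact: measurable_funD.
have slices (C : int -> set (GR * T)) : (forall k, measurable (C k)) ->
    (\int[mu]_x (\esum_(k in [set: int]) P (xsection (C k) x)) =
     \esum_(k in [set: int]) \int[P]_w mu (ysection (C k) w))%E.
  move=> mC; rewrite ge0_integral_esum.
  - apply: eq_esum => k _. exact: integral_sections.
  - by move=> k; exact: (measurable_fun_xsection P (mC k)).
  - by move=> k x; exact: measure_ge0.
transitivity (\int[mu]_x (\esum_(k in [set: int]) P (xsection (A k) x)))%E.
  rewrite ge0_expectation_ccdf// -ge0_integralZl//=; last 2 first.
  - by apply: measurable_funTS; exact: ccdf_measurable.
  - by rewrite lee_fin; exact/ltW/palm.1.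
  rewrite integral_mkcond; apply: eq_integral => x _; rewrite patchE.
  case: ifPn => [|/negP]; rewrite inE/= in_itv/= andbT => x0.
    rewrite /ccdf /distribution /pushforward preimage_itvoy palm_tail.
    apply: eq_esum => k _; congr (P _); apply/seteqP; split=> w /=;
      by rewrite xsectionE /A/= x0.
  rewrite esum1// => k _; rewrite (_ : xsection _ _ = set0) ?measure0//.
  by apply/seteqP; split=> w //=; rewrite xsectionE /A/= => /andP[/x0].
transitivity (\int[mu]_x (\esum_(k in [set: int]) P (xsection (B k) x)))%E.
  rewrite (slices _ mA) (slices _ mB); apply: eq_esum => k _.
  apply: eq_integral => w _.
  (* for a fixed [w] the two slices differ by the translation by [S k w] *)
  transitivity (mu ((fun x => S k w + x) @^-1` ysection (B k) w)); last first.
    apply: lebesgue_measure_translate.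
    exact: (@measurable_ysection _ _ GR T (B k) w (mB k)).
  congr (mu _); apply/seteqP; split=> x /=; rewrite !ysectionE /A /B/=; lra.
transitivity (\int[mu]_(u in `]0%R, 1%R]) P (covered t))%E; last first.
  rewrite integral_cst//= lebesgue_measure_itv/= lte_fin ltr01 sube0 mule1//.
rewrite [RHS]integral_mkcond; apply: eq_integral => u _; rewrite patchE.
case: ifPn => [|/negP]; rewrite inE/= in_itv/= => u01.
  rewrite measure_covered_flow -(measure_covered_flow u) measure_covered_esum.
  apply: eq_esum => k _; congr (P _); apply/seteqP; split=> w /=;
    by rewrite xsectionE /B/= u01.
rewrite esum1// => k _; rewrite (_ : xsection _ _ = set0) ?measure0//.
by apply/seteqP; split=> w //=; rewrite xsectionE /B/= => /andP[/u01].
Qed.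

End PalmInversion.

(** * Expectations *)

(** The tail [exp (- rate * x)] is the density divided by [rate], and the
    density integrates to 1. *)
Lemma expectation_exponential d (T : measurableType d) (R : realType)
    (P : probability T R) (rate : R) (Y : {mfun T >-> R}) :
  0 < rate -> (forall w, 0 <= Y w) ->
  (forall A, measurable A -> distribution P Y A = exponential_prob rate A) ->
  ('E_P[Y] = (rate^-1)%:E)%E.
Proof.
move=> rate0 Y0 Ylaw; rewrite ge0_expectation_ccdf//.
have mpdf : measurable_fun [set: R] (EFin \o exponential_pdf rate).
  by apply/measurable_EFinP; exact: measurable_exponential_pdf.
(* the closed form of the mass of [0, x] is for [0 < x], hence the open end *)
rewrite -integral_itv_obnd_cbnd; last first.
  by apply: measurable_funTS; exact: ccdf_measurable.
transitivity (\int[lebesgue_measure]_(x in `]0%R, +oo[)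
    ((rate^-1)%:E * (exponential_pdf rate x)%:E))%E.
  apply: eq_integral => x; rewrite inE/= in_itv/= andbT => x0.
  rewrite ccdf_1_cdf /cdf (_ : distribution P Y _ = distribution P Y `[0, x]).
    rewrite Ylaw// exponential_prob_itv0c// exponential_pdfE ?ltW//.
    by rewrite -EFinM mulKf ?gt_eqF// -EFinB; congr EFin; ring.
  by congr (P _); apply/seteqP; split=> w /=; rewrite !in_itv/= Y0.
rewrite integral_itv_obnd_cbnd; last first.
  by apply: measurable_funTS; exact: measurable_funeM.
rewrite ge0_integralZl//=; last 3 first.
- exact: measurable_funTS.
- by move=> x _; rewrite lee_fin exponential_pdf_ge0 ?ltW.
- by rewrite lee_fin invr_ge0 ltW.
rewrite (_ : (\int[_]_(x in _) _ = 1)%E) ?mule1//.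
rewrite -(integral_exponential_pdf rate0) integral_mkcond.
apply: eq_integral => x _; rewrite patchE; case: ifPn => // /negP.
rewrite inE/= in_itv/= andbT => /negP; rewrite -ltNge => x0.
by rewrite lt0_exponential_pdf.
Qed.

(** A zero mean would force [Y] to vanish almost everywhere. *)
Lemma expectation_neq0 d (T : measurableType d) (R : realType)
    (P : probability T R) (Y : {mfun T >-> R}) :
  (forall w, 0 < Y w) -> ('E_P[Y] != 0)%E.
Proof.
move=> Y0; apply/negP => /eqP; rewrite expectation_def => EY.
have mY : measurable_fun [set: T] (EFin \o Y) by exact/measurable_EFinP.
have /(ae_eq_integral_abs P measurableT mY) : (\int[P]_w `|(EFin \o Y) w| = 0)%E.
  by rewrite -EY; apply: eq_integral => w _; rewrite /= ger0_norm ?ltW.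
move=> [N [mN PN NY]]; have : P [set: T] = 0%E.
  apply/eqP; rewrite eq_le measure_ge0 andbT -PN.
  apply: le_measure; rewrite ?inE// => w _.
  apply: NY => /= /(_ I) [] Yw0; by have := Y0 w; rewrite Yw0 ltxx.
by rewrite probability_setT => /eqP; rewrite onee_eq0.
Qed.

Lemma integrable_le1 d (T : measurableType d) (R : realType)
    (P : probability T R) (f : T -> R) :
  measurable_fun [set: T] f -> (forall w, `|f w| <= 1) ->
  P.-integrable [set: T] (EFin \o f).
Proof.
move=> mf f1; apply: (@le_integrable _ _ _ P _ measurableT _ (cst 1%E)).
- exact/measurable_EFinP.
- by move=> w _; rewrite /= lee_fin normr1.
- exact: finite_measure_integrable_cst.
Qed.

Lemma Rintegral_setC d (T : measurableType d) (R : realType)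
    (P : probability T R) (f : T -> R) (E : set T) :
  measurable E -> measurable_fun [set: T] f -> (forall w, `|f w| <= 1) ->
  \int[P]_w f w = \int[P]_w (f w * \1_E w) + \int[P]_w (f w * \1_(~` E) w).
Proof.
move=> mE mf f1.
have f1E (A : set T) : measurable A ->
    P.-integrable [set: T] (EFin \o (fun w => f w * \1_A w)).
  move=> mA; apply: integrable_le1.
    by apply: measurable_funM => //; exact: measurable_indic.
  move=> w; rewrite indicE normrM; case: (w \in A) => /=.
    by rewrite normr1 mulr1.
  by rewrite normr0 mulr0.
rewrite -RintegralD//; [|exact: f1E|exact/f1E/measurableC].
apply: eq_Rintegral => w _; rewrite !indicE in_setC.
by case: (w \in E) => /=; rewrite mulr0 mulr1 ?addr0 ?add0r.
Qed.

Lemma cexpect_split d (T : measurableType d) (R : realType)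
    (P : probability T R) (Y : T -> R[i]) (E : set T) :
  measurable E ->
  measurable_fun [set: T] (fun w => complex.Re (Y w)) ->
  measurable_fun [set: T] (fun w => complex.Im (Y w)) ->
  (forall w, `|Y w| <= 1) ->
  cexpect P Y = cexpect_on P E Y + cexpect_on P (~` E) Y.
Proof.
move=> mE mRe mIm Y1.
have Re1 w : `|complex.Re (Y w)| <= 1.
  by rewrite -lecR; exact: le_trans (normc_ge_Re _) (Y1 w).
have Im1 w : `|complex.Im (Y w)| <= 1.
  have := Y1 w; case: (Y w) => a b; rewrite normc_def/= -[1]/(1%:C) lecR.
  by apply: le_trans; rewrite -sqrtr_sqr ler_wsqrtr// lerDr sqr_ge0.
rewrite /cexpect_on /cexpect 
  (@Rintegral_setC _ _ _ P (fun w => complex.Re (Y w)) _ mE)//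
  (@Rintegral_setC _ _ _ P (fun w => complex.Im (Y w)) _ mE)//.
have ReM (z : R[i]) (r : R) : complex.Re (z * r%:C) = complex.Re z * r.
  by case: z => a b /=; rewrite mulr0 subr0.
have ImM (z : R[i]) (r : R) : complex.Im (z * r%:C) = complex.Im z * r.
  by case: z => a b /=; rewrite mulr0 add0r.
by congr (_ +i* _); congr (_ + _); apply: eq_Rintegral => w _; rewrite ?ReM ?ImM.
Qed.

(** * The server in the stationary regime *)

Section VacationQueue.
Context {R : realType} {d : measure_display} {T : measurableType d}.
Context {P P0 : probability T R} {theta : R -> T -> T} {rule : repeat_rule}.
Context {X : vacation_queue R T} {nu : R}.
Hypothesis dynamics : queue_dynamics rule X.
Hypothesis steady : stationary_flow P theta.
Hypothesis compatible : flow_compatible theta X.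
Hypothesis palm : is_palm P theta (cycle_start X) nu P0.

Lemma cycle_start_lt n w : cycle_start X n w < cycle_start X (n + 1) w.
Proof.
have := cycle_succ dynamics n w; have := uptime_gt0 dynamics n w.
by have := downtime_gt0 dynamics n w; rewrite /cycle_down; lra.
Qed.

Lemma uptime_fits n w :
  cycle_start X n w + uptime X n w <= cycle_start X (n + 1) w.
Proof.
have := cycle_succ dynamics n w; have := uptime_gt0 dynamics n w.
by have := downtime_gt0 dynamics n w; rewrite /cycle_down; lra.
Qed.

Lemma uptime_shift t w : exists m : int, forall k,
  cycle_start X k (theta t w) = cycle_start X (k + m) w - t /\
  uptime X k (theta t w) = uptime X (k + m) w.
Proof.
by have [m Hm] := cycle_shift compatible t w; exists m => k; case: (Hm k).
Qed.

Lemma measurable_server_up t : measurable (server_up X t).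
Proof. exact: (@measurable_covered _ _ _ (cycle_start X) (uptime X) t). Qed.

(** Every instant belongs to exactly one cycle, in which the uptime comes before
    the downtime. *)
Lemma server_downE t : server_down X t = ~` server_up X t.
Proof.
apply/seteqP; split=> w.
  move=> [k /andP[k1 k2]] [m /andP[m1 m2]].
  have mk : m = k.
    apply: (@index_unique _ _ _ (cycle_start X) cycle_start_lt _ _ w t).
      rewrite k2 andbT; apply: le_trans k1.
      by rewrite lerDl ltW// (uptime_gt0 dynamics).
    by rewrite m1; apply: lt_le_trans m2 (uptime_fits _ _).
  by move: m2; rewrite mk ltNge k1.
move=> notup; have [k /andP[k1 k2]] := cycle_cover dynamics t w.
exists k; rewrite k2 andbT leNgt; apply/negP => k3; apply: notup.
by exists k; rewrite k1 k3.
Qed.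

Lemma measure_server_up t : (nu%:E * 'E_P0[uptime X 0] = P (server_up X t))%E.
Proof.
apply: (palm_inversion cycle_start_lt (cycle_origin dynamics) _ uptime_fits
  steady palm uptime_shift).
by move=> n w; exact/ltW/(uptime_gt0 dynamics).
Qed.

(** The cycles fill the time line: this is Palm inversion for the intervals
    formed by whole cycles, which cover every instant with probability 1. *)
Lemma mean_cycle :
  (nu%:E * ('E_P0[uptime X 0] + 'E_P0[downtime X 0]) = 1)%E.
Proof.
pose V k := [the {mfun T >-> R} of uptime X k \+ downtime X k].
have -> : ('E_P0[uptime X 0] + 'E_P0[downtime X 0] = 'E_P0[V 0%R])%E.
  rewrite !expectation_def -ge0_integralD//.
  - by move=> w _; rewrite lee_fin ltW// (uptime_gt0 dynamics).
  - exact/measurable_EFinP.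
  - by move=> w _; rewrite lee_fin ltW// (downtime_gt0 dynamics).
  - exact/measurable_EFinP.
have Vcycle k w : cycle_start X (k + 1) w = cycle_start X k w + V k w.
  by rewrite (cycle_succ dynamics) /V/= addrA.
rewrite (@palm_inversion _ _ _ P P0 theta nu (cycle_start X) V
  cycle_start_lt (cycle_origin dynamics) _ _ steady palm _ 0).
- rewrite (_ : covered 0 = [set: T]) ?probability_setT//.
  apply/seteqP; split=> // w _; have [k Hk] := cycle_cover dynamics 0 w.
  by exists k; rewrite -Vcycle.
- move=> n w.
  by rewrite addr_ge0 ?ltW ?(uptime_gt0 dynamics) ?(downtime_gt0 dynamics).
- by move=> n w; rewrite Vcycle.
- move=> t w; have [m Hm] := cycle_shift compatible t w; exists m => k.
  by have [SE UE DE] := Hm k; rewrite SE /V/= UE DE.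
Qed.

End VacationQueue.

Theorem theorem3p5 (R : realType) (d : measure_display) (T : measurableType d)
  (P P0 : probability T R) (theta : R -> T -> T) (X : vacation_queue R T)
  (rule : repeat_rule) (lambda sigma nu : R) (chi g : R[i] -> R[i])
  (lambda_gt0 : 0 < lambda) (sigma_gt0 : 0 < sigma)
  (dynamics : queue_dynamics rule X)
  (steady : stationary_flow P theta)
  (compatible : flow_compatible theta X)
  (palm : is_palm P theta (cycle_start X) nu P0)
  (transition : transition_functions chi g)
  (law : model_law P0 X lambda sigma chi g)
  (stability : stable P0 X lambda)
  (t : R) (p : R[i]) (p_le1 : `|p| <= 1) :
  let EU := mean_uptime P0 X in
  let ED := mean_downtime P0 X in
  let p_up := EU / (EU + ED) in
  let p_down := ED / (EU + ED) in
  let pL := fun w : T => p ^+ queue_length X t w in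
  [/\ cexpect P pL =
        p_up%:C * cexpect_given P (server_up X t) pL +
        p_down%:C * cexpect_given P (server_down X t) pL,
      p_up = 1 / (1 + sigma * ED) &
      p_down = sigma * ED / (1 + sigma * ED)].
Proof.
move=> EU ED p_up p_down pL.
have EUE : ('E_P0[uptime X 0] = (sigma^-1)%:E)%E.
  apply: expectation_exponential => // [w|]; last exact: (uptime_law law 0).
  exact/ltW/(uptime_gt0 dynamics).
have EDE : ('E_P0[downtime X 0] = ED%:E)%E.
  have [r [s [_ _ H]]] := downtime_mean law.
  by rewrite /ED /mean_downtime H.
have EUsigma : EU = sigma^-1 by rewrite /EU /mean_uptime EUE.
have EU_gt0 : 0 < EU by rewrite EUsigma invr_gt0.
(* conditioning on the server being down needs an event of positive mass *)
have ED_gt0 : 0 < ED.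
  rewrite lt_neqAle -lee_fin -EDE expectation_ge0 ?andbT; last first.
    by move=> w; exact/ltW/(downtime_gt0 dynamics).
  have := expectation_neq0 _ _ _ P0 _ (downtime_gt0 dynamics 0).
  by rewrite EDE eqe eq_sym.
have nuE : nu * (EU + ED) = 1.
  have := mean_cycle dynamics steady compatible palm.
  by rewrite EUE EDE -EFinD -EFinM -EUsigma => -[].
have S_neq0 : EU + ED != 0 by rewrite gt_eqF ?addr_gt0.
have PupE : P (server_up X t) = p_up%:E.
  rewrite -(measure_server_up dynamics steady compatible palm) EUE -EFinM.
  rewrite -EUsigma /p_up; congr EFin.
  by rewrite -(mulfK S_neq0 nu) nuE mulrC mul1r.
have mup : measurable (server_up X t) by exact: measurable_server_up.
have PdownE : P (server_down X t) = p_down%:E.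
  rewrite (server_downE dynamics) probability_setC// PupE -EFinB; congr EFin.
  by rewrite /p_up /p_down -{1}(divff S_neq0) -mulrBl; congr (_ / _); ring.
split.
- have pL1 w : `|pL w| <= 1 by rewrite normrX exprn_ile1.
  have mqueue (f : nat -> R) :
      measurable_fun [set: T] (fun w => f (queue_length X t w)).
    by apply: (@measurableT_comp _ _ _ _ _ _ f).
  have p_up0 : (p_up%:C : R[i]) != 0.
    by rewrite fmorph_eq0 mulf_neq0 ?invr_eq0// gt_eqF.
  have p_down0 : (p_down%:C : R[i]) != 0.
    by rewrite fmorph_eq0 mulf_neq0 ?invr_eq0// gt_eqF.
  rewrite /cexpect_given PupE PdownE/= !mulrA ![_%:C * _]mulrC !mulfK//.
  rewrite (server_downE dynamics); apply: cexpect_split => //.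
  + exact: (mqueue (fun n => complex.Re (p ^+ n))).
  + exact: (mqueue (fun n => complex.Im (p ^+ n))).
- rewrite /p_up EUsigma; field.
  by rewrite !gt_eqF ?ltr_wpDl ?mulr_ge0 ?ltW ?ltr_pwDl ?mulr_gt0.
- rewrite /p_down EUsigma; field.
  by rewrite !gt_eqF ?ltr_wpDl ?mulr_ge0 ?ltW ?ltr_pwDl ?mulr_gt0.
Qed.
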